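(* Let $k \ge 3$, let $0 \le v < \lvert I_{k-2}\rvert$, and let $0 \le u \le 2^{k-1}-b_k$ be integers. Then $$\ell c(B_{a_k+v})=\ell c(B_{a_{k-2}+v}),$$ $$\ell c(B_{b_k+u})=\ell c(B_{a_{k-1}+u}),$$ $$\ell c(B_{2^k-(b_k+u)})=\ell c(B_{a_{k-1}+u}),$$ $$\ell c(B_{c_k+v})=\ell c(B_{2^{k-2}-(a_{k-2}+v)})+\ell c(B_{a_{k-2}+v}).$$
   Context: The Stern polynomials $B_n(t)\in\mathbb{Z}[t]$ are defined by $B_0=0$, $B_1=1$, $B_{2n}=tB_n$, $B_{2n+1}=B_n+B_{n+1}$; $\ell c$ denotes the leading coefficient in $t$. A BSD representation of an integer $n$ is a digit string $(b_{m-1}\cdots b_0)$ with $b_j\in\{1,0,-1\}$ and $n=\sum b_j2^j$. A non-adjacent form (NAF) is a BSD representation in which no two adjacent digits are both nonzero; it is reduced if its leading digit is nonzero. Every positive integer has exactly one reduced NAF; its length is the NAF-bitlength of $n$. $I_k$ denotes the set of positive integers of NAF-bitlength $k$; it is a set of consecutive integers (e.g. $I_1=\{1\}$, $I_2=\{2\}$, $I_3=\{3,4,5\}$), and for $k\ge3$, $\lvert I_k\rvert=2\lvert I_{k-2}\rvert+\lvert I_{k-1}\rvert$. Write $a_k=\min I_k$ for $k\ge1$ and $a_0=0$ (equivalently $a_1=1,a_2=2$, $a_k=2^{k-2}+a_{k-2}$). For $k\ge3$, $I_k$ is partitioned into consecutive subintervals $\mathcal{A}_k$ (first $\lvert I_{k-2}\rvert$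 elements), $\mathcal{B}_k$ (next $\lvert I_{k-1}\rvert$ elements), $\mathcal{C}_k$ (last $\lvert I_{k-2}\rvert$ elements), with minima $a_k$, $b_k=a_k+\lvert I_{k-2}\rvert$, $c_k=b_k+\lvert I_{k-1}\rvert=2^{k-1}+a_{k-2}$. *)

(* Defs.v *)
From HB Require Import structures.
From mathcomp Require Import all_boot all_order all_algebra.
From mathcomp Require Import zify.
Set Implicit Arguments.
Unset Strict Implicit.
Unset Printing Implicit Defensive.
Import Order.TTheory GRing.Theory Num.Theory.

Local Open Scope ring_scope.

(* The fuel n suffices for stern n; the recursion equations are the lemmas
   stern0, stern1, stern_double and stern_doubleS below. *)
Fixpoint stern_rec (fuel n : nat) : {poly int} :=
  if fuel is fuel'.+1 then
    if (n <= 1)%N then n%:R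
    else if odd n then stern_rec fuel' n./2 + stern_rec fuel' n./2.+1
    else 'X * stern_rec fuel' n./2
  else 0.

Definition stern (n : nat) : {poly int} := stern_rec n n.

Definition lc_stern (n : nat) : int := lead_coef (stern n).

Lemma stern_rec_fuel f n : (n <= f)%N -> stern_rec f n = stern n.
Proof.
rewrite /stern; elim/ltn_ind: n f => -[|n] IH [|f] //=.
rewrite ltnS => le_nf; case: ifP => // n0.
have half_le : (uphalf n <= n)%N by lia.
rewrite !(IH (uphalf n)) //; [|lia..].
case: ifP => // on.
by rewrite (IH (uphalf n).+1 _ f) ?(IH (uphalf n).+1 _ n) //; lia.
Qed.

Lemma stern0 : stern 0 = 0. Proof. by []. Qed.

Lemma stern1 : stern 1 = 1. Proof. by []. Qed.

Lemma sternE n : (1 < n)%N ->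
  stern n = if odd n then stern n./2 + stern n./2.+1 else 'X * stern n./2.
Proof.
case: n => // n n1; rewrite {1}/stern [LHS]/= leqNgt n1 /=.
rewrite !(@stern_rec_fuel n (uphalf n)); [|lia..].
by case: ifP => // on; rewrite stern_rec_fuel //; lia.
Qed.

Lemma stern_double n : stern (2 * n) = 'X * stern n.
Proof.
case: n => [|n]; first by rewrite muln0 stern0 mulr0.
rewrite sternE; last by lia.
by rewrite mul2n odd_double doubleK.
Qed.

Lemma stern_doubleS n : stern (2 * n).+1 = stern n + stern n.+1.
Proof.
case: n => [|n]; first by rewrite muln0 stern0 add0r.
rewrite sternE; last by lia.
by rewrite mul2n /= odd_double /= uphalf_double.
Qed.

(* Digit strings (b_{m-1} ... b_0) are finite functions j |-> b_j. *)
Notation digit := (seq_sub ([:: 1; 0; -1] : seq int)).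

Definition bsd_value (m : nat) (b : {ffun 'I_m -> digit}) : int :=
  \sum_(j < m) ssval (b j) * 2 ^+ j.

Definition is_naf (m : nat) (b : {ffun 'I_m -> digit}) : bool :=
  [forall i : 'I_m, forall j : 'I_m,
     (j == i.+1 :> nat) ==> ((ssval (b i) == 0) || (ssval (b j) == 0))].

Definition is_reduced (m : nat) (b : {ffun 'I_m -> digit}) : bool :=
  [exists i : 'I_m, (i.+1 == m :> nat) && (ssval (b i) != 0)].

Definition has_naf_bitlength (k n : nat) : bool :=
  [exists b : {ffun 'I_k -> digit},
     [&& is_naf b, is_reduced b & bsd_value b == n%:Z]].

(* I_k as a sorted list without repetition. Searching below 2 ^ k loses
   nothing, see mem_Iset. *)
Definition Iset (k : nat) : seq nat :=
  [seq n <- iota 0 (2 ^ k) | (0 < n)%N && has_naf_bitlength k n].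

Definition card_Iset (k : nat) : nat := size (Iset k).

(* head gives the minimum because Iset k is sorted, see aminP. *)
Definition amin (k : nat) : nat := if k is 0 then 0%N else head 0%N (Iset k).

Definition bmin (k : nat) : nat := (amin k + card_Iset (k - 2))%N.

Definition cmin (k : nat) : nat := (bmin k + card_Iset (k - 1))%N.

Lemma bsd_value_lt m (d : {ffun 'I_m -> digit}) : bsd_value d < 2 ^+ m.
Proof.
have le1 : forall x : digit, ssval x <= 1.
  by case=> x /=; rewrite !inE => /or3P[] /eqP->.
have -> : (2 : int) ^+ m = \sum_(j < m) 2 ^+ j + 1.
  elim: m {d} => [|m IH]; first by rewrite big_ord0 add0r.
  by rewrite big_ord_recr /= addrAC -IH exprS mulrDl mul1r.
rewrite ltzD1; apply: ler_sum => j _.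
by rewrite -[leRHS]mul1r ler_wpM2r // exprn_ge0.
Qed.

Lemma mem_Iset k n : (n \in Iset k) = (0 < n)%N && has_naf_bitlength k n.
Proof.
rewrite mem_filter mem_iota add0n leq0n andTb.
case: (boolP (_ && has_naf_bitlength k n)) => // /andP[_ /existsP[d]].
move=> /and3P[_ _ /eqP dn]; move: (bsd_value_lt d).
have -> : (2 : int) ^+ k = (2 ^ k)%N%:Z by rewrite -[RHS]natz natrX.
by rewrite dn ltz_nat.
Qed.

Lemma uniq_Iset k : uniq (Iset k).
Proof. by rewrite filter_uniq ?iota_uniq. Qed.

Lemma sorted_Iset k : sorted ltn (Iset k).
Proof. by apply: sorted_filter (iota_ltn_sorted _ _); apply: ltn_trans. Qed.

Lemma expn2_in_Iset k : (2 ^ k)%N \in Iset k.+1.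
Proof.
rewrite mem_Iset expn_gt0 /=; apply/existsP.
have h1 : (1 : int) \in ([:: 1; 0; -1] : seq int) by rewrite !inE.
have h0 : (0 : int) \in ([:: 1; 0; -1] : seq int) by rewrite !inE.
exists [ffun j : 'I_k.+1 => if j == ord_max then SeqSub h1 else SeqSub h0].
apply/and3P; split.
- apply/forallP=> i; apply/forallP=> j; apply/implyP=> /eqP ji.
  rewrite !ffunE; have [ei|//] := eqVneq i ord_max; move: (ltn_ord j).
  by rewrite ji ei /= ltnn.
- by apply/existsP; exists ord_max; rewrite ffunE !eqxx.
- apply/eqP; rewrite /bsd_value (bigD1 ord_max) //= ffunE eqxx mul1r.
  rewrite big1 ?addr0 => [|j /negbTE jk]; last by rewrite ffunE jk mul0r.
  by rewrite -[RHS]natz natrX.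
Qed.

Lemma aminP k : (0 < k)%N ->
  amin k \in Iset k /\ (forall n, n \in Iset k -> (amin k <= n)%N).
Proof.
case: k => // k _ /=; move: (expn2_in_Iset k) (sorted_Iset k.+1).
case: (Iset k.+1) => //= x s _ /(order_path_min ltn_trans)/allP xs.
split=> [|n]; first exact: mem_head.
by rewrite inE => /predU1P[->//|/xs/ltnW].
Qed.

(* Main.v *)
Require Import Defs.
From mathcomp Require Import all_boot all_order all_algebra.
From mathcomp Require Import zify.
Set Implicit Arguments.
Unset Strict Implicit.
Unset Printing Implicit Defensive.
Import Order.TTheory GRing.Theory Num.Theory.
Local Open Scope ring_scope.

(** For [r <= 2^m], [B_(2^m q + r) = B_(2^m - r) B_q + B_r B_(q+1)]. With
    [m = k - 2] and [q] equal to 1 or 2, every left-hand side of the theorem is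
    thus a combination of [B_w] and [B_(2^m - w)], and its leading coefficient
    is decided by comparing degrees: [deg B_r < deg B_(2^m - r)] for [r < a_m],
    with equality for [a_m <= r <= 2^m - a_m] (all leading coefficients are
    nonnegative, so nothing cancels). This comparison is proved by induction on
    [m], halving [r]. Finally [I_k] is the interval [[a_k, a_(k+1))], where
    [a_k] is [(2^k + 2) / 3] rounded down. *)

(** * Leading coefficients of Stern polynomials *)

Lemma lead_coef_mulXD (R : nzRingType) (p q : {poly R}) :
  p != 0 -> (size q <= size p)%N -> lead_coef (p * 'X + q) = lead_coef p.
Proof. by move=> p0 le_qp; rewrite lead_coefDl ?lead_coefMX // size_mulX. Qed.

Section NonnegLeadCoef.
Context {R : numDomainType}.
Implicit Types p q : {poly R}.

(** When the sizes agree, the top coefficient of the sum is a positive number plus a nonnegative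
    one, so it survives. *)
Lemma size_addr_lead_ge0 p q : 0 <= lead_coef p -> 0 <= lead_coef q ->
  size (p + q) = maxn (size p) (size q).
Proof.
move=> p0 q0; case: (ltngtP (size p) (size q)) => [lt_pq|lt_qp|eq_pq].
- by rewrite addrC size_polyDl.
- by rewrite size_polyDl.
have [p_0|p_neq0] := eqVneq p 0; first by rewrite p_0 add0r -eq_pq p_0.
apply/eqP; rewrite eqn_leq (leq_trans (size_polyD _ _)) ?eq_pq ?maxnn //=.
have sz_p : (0 < size p)%N by rewrite size_poly_gt0.
rewrite -eq_pq -(prednK sz_p) ltnNge; apply/negP => /leq_sizeP/(_ _ (leqnn _)).
rewrite coefD {2}eq_pq -!lead_coefE => /eqP.
by rewrite gt_eqF // ltr_wpDr // lt0r lead_coef_eq0 p_neq0.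
Qed.

Lemma lead_coef_addr_ge0 p q : 0 <= lead_coef p -> 0 <= lead_coef q ->
  size p = size q -> lead_coef (p + q) = lead_coef p + lead_coef q.
Proof.
move=> p0 q0 eq_pq; rewrite lead_coefE size_addr_lead_ge0 // -eq_pq maxnn.
by rewrite coefD [in X in _ + X]eq_pq -!lead_coefE.
Qed.

Lemma lead_coef_ge0D p q : 0 <= lead_coef p -> 0 <= lead_coef q ->
  0 <= lead_coef (p + q).
Proof.
move=> p0 q0; case: (ltngtP (size p) (size q)) => [lt_pq|lt_qp|eq_pq].
- by rewrite addrC lead_coefDl.
- by rewrite lead_coefDl.
- by rewrite lead_coef_addr_ge0 ?addr_ge0.
Qed.

End NonnegLeadCoef.

Lemma double_or_doubleS n : exists s, n = (2 * s)%N \/ n = (2 * s).+1.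
Proof. by exists n./2; lia. Qed.

Lemma stern_lead_coef_ge0 n : 0 <= lead_coef (stern n).
Proof.
elim/ltn_ind: n => n IH.
have [n1|n1] := leqP n 1.
  by case: n n1 {IH} => [|[|]] // _; rewrite ?stern0 ?stern1 ?lead_coef0 ?lead_coef1.
have [s [ns|ns]] := double_or_doubleS n; rewrite ns.
- by rewrite stern_double lead_coefM lead_coefX mul1r IH //; lia.
- by rewrite stern_doubleS lead_coef_ge0D ?IH //; lia.
Qed.

(* A constant, so that [lia] sees one atom per index whatever the coercion path
   to the coefficient ring in [size (stern n)]. *)
Definition size_stern (n : nat) : nat := size (stern n).

Lemma size_stern_doubleS n :
  size_stern (2 * n).+1 = maxn (size_stern n) (size_stern n.+1).
Proof. by rewrite /size_stern stern_doubleS size_addr_lead_ge0 ?stern_lead_coef_ge0. Qed.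

Lemma stern_neq0 n : (0 < n)%N -> stern n != 0.
Proof.
elim/ltn_ind: n => n IH n_gt0; rewrite -size_poly_gt0 -[size _]/(size_stern n).
have [n1|n1] := leqP n 1.
  by have -> : n = 1%N by [lia]; rewrite /size_stern stern1 size_poly1.
have [s [ns|ns]] := double_or_doubleS n; rewrite ns.
- by rewrite /size_stern stern_double mulrC size_mulX // IH //; lia.
- by rewrite size_stern_doubleS leq_max !size_poly_gt0 IH //; lia.
Qed.

Lemma size_stern_double n : (0 < n)%N ->
  size_stern (2 * n) = (size_stern n).+1.
Proof.
by move=> n0; rewrite /size_stern stern_double mulrC size_mulX ?stern_neq0.
Qed.

Lemma size_stern0 : size_stern 0 = 0%N.
Proof. by rewrite /size_stern stern0 size_poly0. Qed.

(** Induction on [m], halving [r]. For [r = 2s + 1] the identities at [s] and [s + 1] are added; the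
    recursion reassembles the coefficients of [stern q] and of [stern q.+1]. *)
Lemma stern_block m q r : (r <= 2 ^ m)%N ->
  stern (2 ^ m * q + r) = stern (2 ^ m - r) * stern q + stern r * stern q.+1.
Proof.
elim: m r => [|m IH] r le_r.
  case: r le_r => [|[|//]] _.
    by rewrite !expn0 mul1n addn0 subn0 stern1 stern0 mul1r mul0r addr0.
  by rewrite !expn0 mul1n addn1 subnn stern1 stern0 mul1r mul0r add0r.
rewrite expnS in le_r *.
have [s [rs|rs]] := double_or_doubleS r; rewrite rs in le_r *.
- have -> : (2 * 2 ^ m * q + 2 * s = 2 * (2 ^ m * q + s))%N by lia.
  have -> : (2 * 2 ^ m - 2 * s = 2 * (2 ^ m - s))%N by lia.
  by rewrite !stern_double IH ?mulrDr ?mulrA //; lia.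
- have -> : (2 * 2 ^ m * q + (2 * s).+1 = (2 * (2 ^ m * q + s)).+1)%N by lia.
  have -> : (2 * 2 ^ m - (2 * s).+1 = (2 * (2 ^ m - s.+1)).+1)%N by lia.
  rewrite !stern_doubleS -addnS !IH; [|lia..].
  have -> : ((2 ^ m - s.+1).+1 = 2 ^ m - s)%N by lia.
  by rewrite addrACA -!mulrDl [X in X * stern q]addrC.
Qed.

(** * Degrees of [B_r] and [B_(2^m - r)] *)

(* Differs from [amin] at 0, where [nafmin 0 = 1]: this is the value for which
   [nafmin_double] and [nafminSS] hold without exception. *)
Definition nafmin (k : nat) : nat := ((2 ^ k + 2) %/ 3)%N.

Lemma nafmin_double k : nafmin k.+1 = (2 * nafmin k - ~~ odd k)%N.
Proof.
(* The residue of [2 ^ k] modulo 3 alternates with the parity of [k] and decides the rounding. *)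
suff [mod3 -> ]: (2 ^ k %% 3 = if odd k then 2 else 1)%N /\
    nafmin k.+1 = ((2 * 2 ^ k + 2) %/ 3)%N by rewrite /nafmin; case: odd mod3; lia.
split; last by rewrite /nafmin expnS.
elim: k => // k IH; rewrite expnS /=; case: (odd k) IH => /=; lia.
Qed.

Lemma nafmin_gt0 k : (0 < nafmin k)%N.
Proof. by rewrite /nafmin; have := expn_gt0 2 k; lia. Qed.

(** Hence [r |-> 2 ^ k - r] maps the range from [nafmin k] to [nafmin k.+1 - 1] onto itself. *)
Lemma nafminD k : (nafmin k + nafmin k.+1 = (2 ^ k).+1)%N.
Proof.
elim: k => // k IH; rewrite expnS.
have := nafmin_gt0 k; have := nafmin_double k; have := nafmin_double k.+1.
by rewrite /=; case: (odd k) => /=; lia.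
Qed.

Lemma nafminSS k : (nafmin k.+2 = 2 ^ k + nafmin k)%N.
Proof. by have := nafminD k; have := nafminD k.+1; rewrite expnS; lia. Qed.

Lemma nafmin_leS k : (nafmin k <= nafmin k.+1)%N.
Proof.
by have := nafmin_gt0 k; have := nafmin_double k; case: (odd k) => /=; lia.
Qed.

(** Serves the boundary case of [size_stern_compl]. The slack for odd [k] is absorbed at the next
    step, where the index doubles and its size grows by one. *)
Lemma size_stern_nafmin_pred k : (size_stern (nafmin k).-1 <=
  odd k + size_stern (nafmin k))%N.
Proof.
elim: k => [|k IH]; first by rewrite size_stern0.
have := nafmin_double k; have n0 := nafmin_gt0 k; rewrite /=.
case: (odd k) IH => /= IH nS.
- have -> : nafmin k.+1 = (2 * nafmin k)%N by lia.
  have -> : ((2 * nafmin k).-1 = (2 * (nafmin k).-1).+1)%N by lia.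
  rewrite size_stern_doubleS size_stern_double // prednK //; lia.
- have -> : nafmin k.+1 = (2 * (nafmin k).-1).+1 by lia.
  rewrite size_stern_doubleS succnK prednK //.
  have [->|n1] := posnP (nafmin k).-1; first by rewrite size_stern0.
  by rewrite size_stern_double //; lia.
Qed.

(** For even [r] both sizes grow by one under doubling. For odd [r] both are maxima over two
    neighbours, so the induction hypotheses at [s] and [s + 1] combine. *)
Lemma size_stern_compl m r : (2 * r <= 2 ^ m)%N ->
  if (r < nafmin m)%N then (size_stern r < size_stern (2 ^ m - r))%N
  else size_stern r == size_stern (2 ^ m - r).
Proof.
elim: m r => [|m IH] r le_r.
  by have -> : r = 0%N by [lia]; rewrite size_stern0 /size_stern stern1 size_poly1.
rewrite expnS in le_r *.
have nS := nafmin_double m; have n0 := nafmin_gt0 m; have nD := nafminD m.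
have [s [rs|rs]] := double_or_doubleS r; rewrite rs in le_r *.
- have -> : (2 * 2 ^ m - 2 * s = 2 * (2 ^ m - s))%N by lia.
  have -> : (2 * s < nafmin m.+1)%N = (s < nafmin m)%N.
    by case: (odd m) nS => /=; lia.
  have [->|s0] := posnP s.
    rewrite n0 muln0 size_stern0 size_poly_gt0 stern_neq0 //.
    by have := expn_gt0 2 m; lia.
  rewrite !size_stern_double; [|lia..].
  by have := IH s ltac:(lia); case: ifP => _; lia.
- have [m_0|m0] := posnP m.
    move: le_r; rewrite m_0 expn0 => le_r.
    have -> : s = 0%N by lia.
    exact: (eqxx (size_stern 1)).
  (* As [2 ^ m] is even, [2s + 1 <= 2 ^ m] improves to [2(s + 1) <= 2 ^ m], which the induction
     hypothesis at [s + 1] requires. *)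
  have e2 : (2 ^ m = 2 * 2 ^ m.-1)%N by rewrite -expnS prednK.
  have -> : (2 * 2 ^ m - (2 * s).+1 = (2 * (2 ^ m - s.+1)).+1)%N by lia.
  rewrite !size_stern_doubleS.
  have -> : ((2 ^ m - s.+1).+1 = 2 ^ m - s)%N by lia.
  have IHs : _ := IH s ltac:(lia); have IHs1 : _ := IH s.+1 ltac:(lia).
  (* At the boundary [s + 1 = a_m] the two induction hypotheses point in
     different directions; there [2^m - s = a_(m+1)]. *)
  have [sE|sE] := eqVneq s.+1 (nafmin m); last first.
    have -> : ((2 * s).+1 < nafmin m.+1)%N = (s < nafmin m)%N.
      by case: (odd m) nS => /=; lia.
    by move: IHs IHs1; case: ifP => h; case: ifP; lia.
  have cE : (2 ^ m - s = nafmin m.+1)%N by lia.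
  rewrite sE ltnn -sE in IHs1; rewrite -{1}sE ltnSn in IHs.
  have := size_stern_nafmin_pred m; rewrite -sE succnK.
  (* Here [2 ^ m - s] is [2(s + 1)] for odd [m], and [2s + 1] for even [m]. *)
  case: (odd m) nS => /= nS predle.
  + have -> : ((2 * s).+1 < nafmin m.+1)%N by lia.
    have : size_stern (2 ^ m - s) = (size_stern s.+1).+1.
      by rewrite -size_stern_double //; congr (size_stern _); lia.
    by lia.
  + have -> : ((2 * s).+1 < nafmin m.+1)%N = false by lia.
    have : size_stern (2 ^ m - s) = maxn (size_stern s) (size_stern s.+1).
      by rewrite -size_stern_doubleS; congr (size_stern _); lia.
    by lia.
Qed.

Lemma size_stern_compl_lt m r : (r < nafmin m)%N ->
  (size_stern r < size_stern (2 ^ m - r))%N.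
Proof.
move=> lt_r; have := @size_stern_compl m r; rewrite lt_r; apply.
by have := nafminD m; have := nafmin_leS m; lia.
Qed.

Lemma size_stern_compl_eq m r : (nafmin m <= r < nafmin m.+1)%N ->
  size_stern r = size_stern (2 ^ m - r).
Proof.
move=> r_int; have nD := nafminD m.
have [le_r|gt_r] := leqP (2 * r) (2 ^ m).
  by have := size_stern_compl le_r; case: ifP => [|_ /eqP //]; lia.
have := @size_stern_compl m (2 ^ m - r) ltac:(lia); rewrite subKn; last by lia.
by case: ifP => [|_ /eqP //]; lia.
Qed.

(** * The interval of integers of given NAF-bitlength *)

(** Digits are indexed by all of [nat], so strings can be truncated or extended without changing
    type. *)
Definition naf_digits (m : nat) (f : nat -> int) : Prop :=
  (forall i, f i \in [:: 1; 0; -1]) /\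
  (forall i, (i.+1 < m)%N -> f i = 0 \/ f i.+1 = 0).

Lemma naf_digits_le m n f : (m <= n)%N -> naf_digits n f -> naf_digits m f.
Proof. by move=> le_mn [fd fn]; split=> // i i_m; apply: fn; lia. Qed.

Definition digits_value (m : nat) (f : nat -> int) : int := \sum_(j < m) f j * 2 ^+ j.

Lemma digits_valueS m f : digits_value m.+1 f = digits_value m f + f m * (2 ^ m)%N%:Z.
Proof. by rewrite /digits_value big_ord_recr /= -[in RHS]natz natrX. Qed.

(** The extreme strings are 1010... and its negative. A nonzero top digit forces a zero below it,
    hence the two-step induction along [nafminSS]. *)
Lemma naf_value_bound m f : naf_digits m f ->
  - (nafmin m.+1)%:Z < digits_value m f < (nafmin m.+1)%:Z.
Proof.
have [n] := ubnP m; elim: n m => // n IH [|[|m]] /ltnSE le_n nf.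
- by rewrite /digits_value big_ord0.
- rewrite digits_valueS /digits_value big_ord0 expn0.
  have := nf.1 0%N; have -> : nafmin 2 = 2%N by [].
  by rewrite !inE => /or3P[] /eqP ->; lia.
rewrite digits_valueS.
have := IH m.+1 le_n (naf_digits_le (leqnSn _) nf).
have := IH m (ltnW le_n) (naf_digits_le (leqW (leqnSn _)) nf).
have := nafmin_leS m.+2; have := nafminSS m.+1.
have [fm0|->] := nf.2 m (leqnn _); last by rewrite mul0r; lia.
by rewrite digits_valueS fm0; have := nf.1 m.+1; rewrite !inE => /or3P[] /eqP ->; lia.
Qed.

Definition cons_top (m : nat) (d : int) (f : nat -> int) (i : nat) : int :=
  if (i < m)%N then f i else if i == m then d else 0.

Lemma digits_value_cons_top m d f n : (n <= m)%N ->
  digits_value n (cons_top m d f) = digits_value n f.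
Proof.
move=> le_nm; apply: eq_bigr => i _.
by rewrite /cons_top (leq_trans (ltn_ord i)).
Qed.

Lemma cons_top_id m d f : cons_top m d f m = d.
Proof. by rewrite /cons_top ltnn eqxx. Qed.

Lemma naf_cons_top0 m f : naf_digits m f -> naf_digits m.+1 (cons_top m 0 f).
Proof.
move=> [fd fn]; split=> [i|i i_m].
  by rewrite /cons_top; do 2?[case: ifP] => // _; rewrite !inE.
rewrite /cons_top; case: (ltnP i.+1 m) => [im|im]; last by right; case: eqP.
by rewrite ltnW //; apply: fn.
Qed.

Lemma naf_cons_top m d f : d \in [:: 1; 0; -1] -> naf_digits m f ->
  naf_digits m.+2 (cons_top m.+1 d (cons_top m 0 f)).
Proof.
move=> dd /naf_cons_top0 [fd fn]; split=> [i|i i_m].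
  by rewrite {1}/cons_top; do 2?[case: ifP] => // _; rewrite !inE.
rewrite {1 3}/cons_top; case: (ltnP i.+1 m.+1) => [im|im].
  by rewrite ltnW //; apply: fn.
have -> : i = m by lia.
by left; rewrite ltnSn cons_top_id.
Qed.

Lemma digits_value_cons_top2 m d f :
  digits_value m.+2 (cons_top m.+1 d (cons_top m 0 f)) =
  digits_value m f + d * (2 ^ m.+1)%N%:Z.
Proof.
rewrite digits_valueS cons_top_id digits_value_cons_top // digits_valueS.
by rewrite cons_top_id mul0r addr0 digits_value_cons_top.
Qed.

(** The top digit is chosen greedily: 1, -1 or 0 as [x] lies above, below or strictly between
    [nafmin m.+2] and its negative. By [nafminD] and [nafminSS] the remainder fits the shorter
    length. *)
Lemma naf_value_exists m (x : int) :
  - (nafmin m.+1)%:Z < x < (nafmin m.+1)%:Z ->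
  exists2 f, naf_digits m f & digits_value m f = x.
Proof.
have [n] := ubnP m; elim: n m x => // n IH [|[|m]] x /ltnSE le_n x_bd.
- exists (fun=> 0); first by split=> // i; rewrite !inE.
  by rewrite /digits_value big_ord0; move: x_bd; have -> : nafmin 1 = 1%N by []; lia.
- exists (cons_top 0 x (fun=> 0)).
    split=> // i; rewrite /cons_top ltn0; case: ifP => _; rewrite !inE //.
    by move: x_bd; have -> : nafmin 2 = 2%N by []; lia.
  by rewrite digits_valueS cons_top_id /digits_value big_ord0 add0r mulr1.
have nSS := nafminSS m.+1; have nD := nafminD m.+1.
have extend (d : int) : d \in [:: 1; 0; -1] ->
    - (nafmin m.+1)%:Z < x - d * (2 ^ m.+1)%N%:Z < (nafmin m.+1)%:Z ->
    exists2 f, naf_digits m.+2 f & digits_value m.+2 f = x.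
  move=> dd /(IH _ _ (ltnW le_n))[f nf fE].
  exists (cons_top m.+1 d (cons_top m 0 f)); first exact: naf_cons_top.
  by rewrite digits_value_cons_top2 fE subrK.
have [x_ge|x_lt] := leP (nafmin m.+2)%:Z x; first by apply: (extend 1) => //; lia.
have [x_le|x_gt] := leP x (- (nafmin m.+2)%:Z).
  by apply: (extend (- 1)); rewrite ?inE //; lia.
have [f nf fE] := IH m.+1 x le_n ltac:(lia).
exists (cons_top m.+1 0 f); first exact: naf_cons_top0.
by rewrite digits_valueS cons_top_id digits_value_cons_top // mul0r addr0.
Qed.

Lemma has_naf_bitlengthP k n : reflect
  (exists f, [/\ naf_digits k.+1 f, f k != 0 & digits_value k.+1 f = n%:Z])
  (has_naf_bitlength k.+1 n).
Proof.
apply: (iffP existsP) => [[b /and3P[nb rb /eqP vb]]|[f [[fd fn] fk fE]]].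
- pose f i : int := if (i <= k)%N then ssval (b (inord i)) else 0.
  have fE (j : 'I_k.+1) : f j = ssval (b j) by rewrite /f -ltnS ltn_ord inord_val.
  exists f; split; first split=> [i|i i_k].
  + rewrite /f; case: ifP => _; last by rewrite !inE.
    exact: ssvalP.
  + have := fE (Ordinal i_k); have := fE (Ordinal (ltnW i_k)) => /= -> ->.
    move/forallP/(_ (Ordinal (ltnW i_k)))/forallP/(_ (Ordinal i_k)): nb.
    by rewrite /= eqxx => /orP[] /eqP ->; [left|right].
  + move: rb => /existsP[i /andP[/eqP ik bi]].
    by have <- : i = k :> nat by [lia]; rewrite fE.
  + by rewrite -vb; apply: eq_bigr => j _; rewrite fE.
- exists [ffun j : 'I_k.+1 => SeqSub (fd j)]; apply/and3P; split.
  + apply/forallP=> i; apply/forallP=> j; apply/implyP=> /eqP ji.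
    rewrite !ffunE /= ji; have := ltn_ord j; rewrite ji => /fn[] ->;
    by rewrite eqxx ?orbT.
  + by apply/existsP; exists ord_max; rewrite ffunE /= eqxx.
  + by rewrite -fE; apply/eqP/eq_bigr => j _; rewrite ffunE.
Qed.

Lemma mem_Iset_nafmin k n :
  (n \in Iset k.+1) = (nafmin k.+1 <= n < nafmin k.+2)%N.
Proof.
rewrite mem_Iset; have nSS := nafminSS k; have nD := nafminD k.
apply/andP/idP => [[n0 /has_naf_bitlengthP[f [nf fk fE]]]|n_bd].
  have lt_n := naf_value_bound nf; rewrite fE in lt_n.
  (* The zero under the leading digit sharpens the general bound [nafmin k.+1] to [nafmin k]; so a
     leading 1 gives [n > 2 ^ k - nafmin k]. *)
  suff v_gt : - (nafmin k)%:Z < digits_value k f.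
    have := naf_value_bound (naf_digits_le (leqnSn _) nf).
    move: fE fk (nf.1 k); rewrite digits_valueS !inE => fE fk.
    by case/or3P=> /eqP fkE; move: fE fk; rewrite fkE //; lia.
  case: k nf fk fE {lt_n} nSS nD => [|k] nf fk fE nSS nD.
    by rewrite /digits_value big_ord0.
  have fk0 : f k = 0 by have [//|f0] := nf.2 k (leqnn _); rewrite f0 in fk.
  rewrite digits_valueS fk0 mul0r addr0.
  by have /andP[] := naf_value_bound (naf_digits_le (leqW (leqnSn _)) nf).
split; first by have := nafmin_gt0 k.+1; lia.
apply/has_naf_bitlengthP; case: k n_bd nSS nD => [|k] n_bd nSS nD.
  have -> : n = 1%N by move: n_bd; rewrite /nafmin; lia.
  exists (cons_top 0 1 (fun=> 0)); split.
  + by split=> // i; rewrite /cons_top ltn0; case: ifP => _; rewrite !inE.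
  + by rewrite cons_top_id.
  + by rewrite digits_valueS cons_top_id /digits_value big_ord0.
have [f nf fE] := @naf_value_exists k (n%:Z - (2 ^ k.+1)%N%:Z) ltac:(lia).
exists (cons_top k.+1 1 (cons_top k 0 f)); split; first exact: naf_cons_top.
  by rewrite cons_top_id.
by rewrite digits_value_cons_top2 fE mul1r subrK.
Qed.

Lemma IsetE k : Iset k.+1 = iota (nafmin k.+1) (nafmin k.+2 - nafmin k.+1).
Proof.
apply: (irr_sorted_eq ltn_trans ltnn (sorted_Iset _) (iota_ltn_sorted _ _)) => n.
by rewrite mem_Iset_nafmin mem_iota subnKC // nafmin_leS.
Qed.

Lemma card_IsetE k : (0 < k)%N -> card_Iset k = (nafmin k.+1 - nafmin k)%N.
Proof. by case: k => // k _; rewrite /card_Iset IsetE size_iota. Qed.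

Lemma aminE k : (0 < k)%N -> amin k = nafmin k.
Proof.
(* Membership of the minimum rules out an empty list, on which [head] would return its default. *)
case: k => // k k0; have [/[swap] _] := aminP k0.
rewrite /amin IsetE mem_iota.
case: (_ - _)%N => [|//]; lia.
Qed.

(** * The four identities for leading coefficients *)

Theorem mainTheorem3 (k v u : nat) (hk : (3 <= k)%N) (hv : (v < card_Iset (k - 2))%N)
    (hu : (bmin k + u <= 2 ^ (k - 1))%N) :
  [/\ lc_stern (amin k + v) = lc_stern (amin (k - 2) + v),
      lc_stern (bmin k + u) = lc_stern (amin (k - 1) + u),
      lc_stern (2 ^ k - (bmin k + u)) = lc_stern (amin (k - 1) + u)
    & lc_stern (cmin k + v) =
        lc_stern (2 ^ (k - 2) - (amin (k - 2) + v)) + lc_stern (amin (k - 2) + v)].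
Proof.
have [m m0 kE] : exists2 m, (0 < m)%N & k = m.+2 by exists (k - 2)%N; lia.
move: hv hu; rewrite /cmin /bmin {}kE subn2 subn1 !succnK !aminE // !card_IsetE //.
have nSS := nafminSS m; have nD := nafminD m; have nS := nafmin_leS m.
move=> hv hu.
rewrite !expnS in hu *.
have stern2 : stern 2 = 'X by rewrite (stern_double 1) stern1 mulr1.
have stern3 : stern 3 = 'X + 1 by rewrite (stern_doubleS 1) stern1 stern2 addrC.
have block1 r : (r <= 2 ^ m)%N ->
    stern (2 ^ m + r) = stern r * 'X + stern (2 ^ m - r).
  by move=> r_le; rewrite -[X in (X + r)%N]muln1 stern_block // stern1 stern2
    mulr1 addrC.
have block2 r : (r <= 2 ^ m)%N ->
    stern (2 ^ m * 2 + r) = (stern (2 ^ m - r) + stern r) * 'X + stern r.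
  by move=> r_le; rewrite stern_block // stern2 stern3 mulrDr mulr1 addrA mulrDl.
have ge0 := stern_lead_coef_ge0.
(* [w] lies in the symmetric range, so its complement has equal size; [2 ^ m - x] lies below
   [nafmin m], so [x] has the larger size. *)
set w := (nafmin m + v)%N; set x := (nafmin m.+1 + u)%N.
have [w_gt0 w_bd w_le] : [/\ (0 < w)%N, (nafmin m <= w < nafmin m.+1)%N & (w <= 2 ^ m)%N].
  by have := nafmin_gt0 m; rewrite /w; split; lia.
have [x_gt0 x_le] : (0 < x)%N /\ (x <= 2 ^ m)%N.
  by have := nafmin_gt0 m; rewrite /x; split; lia.
have szw : size (stern w) = size (stern (2 ^ m - w)) := size_stern_compl_eq w_bd.
have szx : (size (stern (2 ^ m - x)) < size (stern x))%N.
  by have := @size_stern_compl_lt m (2 ^ m - x) ltac:(rewrite /x; lia); rewrite subKn.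
rewrite /lc_stern; split.
- have -> : (nafmin m.+2 + v = 2 ^ m + w)%N by rewrite /w; lia.
  by rewrite block1 // (lead_coef_mulXD (stern_neq0 w_gt0)) // (eq_leq (esym szw)).
- have -> : (nafmin m.+2 + (nafmin m.+1 - nafmin m) + u = 2 ^ m + x)%N
    by rewrite /x; lia.
  by rewrite block1 // (lead_coef_mulXD (stern_neq0 x_gt0)) // ltnW.
(* Reflection moves the index to the block [q = 2], with [x] as the complement of the offset. *)
- have -> : (2 * (2 * 2 ^ m) - (nafmin m.+2 + (nafmin m.+1 - nafmin m) + u) =
            2 ^ m * 2 + (2 ^ m - x))%N by rewrite /x; lia.
  rewrite block2 ?leq_subr // subKn //.
  have sz : size (stern x + stern (2 ^ m - x)) = size (stern x) by rewrite size_polyDl.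
  have nz : stern x + stern (2 ^ m - x) != 0.
    by rewrite -size_poly_gt0 sz size_poly_gt0 stern_neq0.
  by rewrite (lead_coef_mulXD nz) ?sz ?lead_coefDl // ltnW.
- have -> : (nafmin m.+2 + (nafmin m.+1 - nafmin m) + (nafmin m.+2 - nafmin m.+1) + v
            = 2 ^ m * 2 + w)%N by rewrite /w; lia.
  (* Equal sizes and nonnegative leading coefficients: here the two coefficients add up. *)
  have sz : size (stern (2 ^ m - w) + stern w) = size (stern w).
    by rewrite size_addr_lead_ge0 // -szw maxnn.
  have nz : stern (2 ^ m - w) + stern w != 0.
    by rewrite -size_poly_gt0 sz size_poly_gt0 stern_neq0.
  by rewrite block2 // (lead_coef_mulXD nz) ?sz // lead_coef_addr_ge0.
Qed.
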